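(* Let $G$ be a second countable locally compact group and let $\varphi\in\triangle(\mathrm{B}(G))$ be such that for each positive definite function $f\in \mathrm{B}(G)$ the element $\varphi_{f}$ is a unitary in the von Neumann algebra $\mathrm{A}(f)^{\ast}$. Then $\varphi\in\partial(\mathrm{B}(G))$, the Shilov boundary of $\mathrm{B}(G)$.
   Context: $\mathrm{B}(G)$ is the Fourier--Stieltjes algebra of $G$ (linear span of continuous positive definite functions), a commutative unital Banach algebra under pointwise multiplication, identified with the dual of the full group $C^*$-algebra $C^*(G)$. $W^{\ast}(G):=C^*(G)^{**}=\mathrm{B}(G)^*$ is the universal enveloping von Neumann algebra. For $g\in\mathrm{B}(G)$, the central support $\mathrm{zs}(g)$ is the smallest central projection $z\in W^*(G)$ such that $g$ vanishes on $(1-z)W^*(G)$; $g\ll f$ means $\mathrm{zs}(g)\leq\mathrm{zs}(f)$. For a positive definite $f\in\mathrm{B}(G)$ put $\mathrm{A}(f):=\{g\in\mathrm{B}(G): g\ll f\}$, a closed subspace of $\mathrm{B}(G)$. Its dual $\mathrm{A}(f)^*$ is a von Neumann algebra consisting of the restrictions to $\mathrm{A}(f)$ of elements of $W^*(G)$; it is identified with $\mathrm{zs}(f)W^*(G)$. For $\varphi\in\mathrm{B}(G)^*=W^*(G)$, $\varphi_f\in\mathrm{A}(f)^*$ denotes the restriction $\varphi|_{\mathrm{A}(f)}$. $\triangle(A)$ is the set of (nonzero) multiplicative linear functionals on a commutative Banach algebra $A$ with the weak$^*$ topology, and the Shilov boundary $\partial(A)\subset\triangle(A)$ is the smallest closed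 subset on which the Gelfand transform of every element of $A$ attains the maximum of its modulus. *)

(* Defs.v *)
From HB Require Import structures.
From mathcomp Require Import all_boot all_order all_algebra.
From mathcomp Require Import all_classical all_reals all_analysis.
From mathcomp Require Import ring.
From mathcomp.real_closed Require Import complex.

Set Implicit Arguments.
Unset Strict Implicit.
Unset Printing Implicit Defensive.

Import Order.TTheory GRing.Theory Num.Theory.
Import numFieldNormedType.Exports.
Local Open Scope classical_set_scope.
Local Open Scope sesquilinear_scope.
Local Open Scope ring_scope.

HB.mixin Record isTopologicalGroup G of Group G & Topological G := {
  mulg_continuous : continuous (fun xy : G * G => (xy.1 * xy.2)%g);
  invg_continuous : continuous (fun x : G => (x^-1)%g) }.

#[short(type="topologicalGroupType")]
HB.structure Definition TopologicalGroup :=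
  {G of Group G & Topological G & isTopologicalGroup G}.

(* The complex numbers, typed so that the topology of a numFieldType and the
   conjugation of a numClosedFieldType are both inferred. *)
Definition cplx (R : realType) : numClosedFieldType := R[i].

Section PositiveDefinite.
Variables (R : realType) (G : topologicalGroupType).
Local Notation C := (cplx R).

Definition positive_definite (f : G -> C) : Prop :=
  forall n (c : 'I_n -> C) (x : 'I_n -> G),
    0 <= \sum_i \sum_j c i * (c j)^* * f ((x j)^-1 * x i)%g.

Lemma positive_definite_ge0 f : positive_definite f -> 0 <= f 1%g.
Proof.
move=> /(_ 1%N (fun=> 1) (fun=> 1%g)).
by rewrite !big_ord1 rmorph1 !mul1r mulVg.
Qed.

Lemma positive_definiteV f (x : G) :
  positive_definite f -> f (x^-1)%g = (f x)^*.
Proof.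
move=> pf.
have f1 : (f 1%g)^* = f 1%g by apply/CrealP/ger0_real/positive_definite_ge0.
have key t : t^* * f (x^-1)%g + t * f x = (t^* * f (x^-1)%g + t * f x)^*.
  have := pf 2%N (fun i => if i == 0 then 1 else t)
    (fun i => if i == 0 then 1%g else x).
  rewrite !big_ord_recl !big_ord0 /= !addr0 rmorph1 !mul1r !mulVg !mulr1.
  rewrite invg1 mul1g mulg1 => /ger0_real/CrealP.
  rewrite !rmorphD/= !rmorphM/= !conjCK f1 (mulrC t^* t).
  set a := t^* * _; set b := t * _; set d := t * t^* * _; set u := f 1%g.
  set e := t * _; set h := t^* * _ => E.
  by apply: (@addrI _ u); apply: (@addIr _ d); rewrite -!addrA !addrA in E *.
have := key 1; rewrite rmorph1 !mul1r rmorphD /= => E1.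
have := key 'i; rewrite rmorphD !rmorphM /= !conjCK conjCi.
rewrite !mulNr => E2.
have {}E2 : f x - f (x^-1)%g = (f (x^-1)%g)^* - (f x)^*.
  apply: (mulfI (neq0Ci C)); rewrite !mulrBr.
  by rewrite addrC E2.
have two : (2 : C) != 0 by rewrite pnatr_eq0.
apply: (mulfI two).
rewrite (_ : 2 * _ = (f (x^-1)%g + f x) - (f x - f (x^-1)%g)); last by ring.
by rewrite E1 E2; ring.
Qed.

Lemma positive_definiteM f g :
  positive_definite f -> positive_definite g -> positive_definite (f \* g).
Proof.
move=> pf pg n c x.
pose A : 'M[C]_n := \matrix_(i, j) f ((x j)^-1 * x i)%g.
have Aherm : A \is hermsymmx.
  rewrite is_hermitianmxE expr0 scale1r; apply/eqP/matrixP => i j.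
  by rewrite !mxE -positive_definiteV// invgM invgK.
have Anormal := hermitian_normalmx Aherm.
have /orthomx_spectralP := Anormal.
rewrite invmx_unitary ?spectral_unitarymx//.
set P := spectralmx A; set d := spectral_diag A => Adec.
have AE i j : A i j = \sum_k (P k i)^* * d 0 k * P k j.
  rewrite {1}Adec mxE; apply: eq_bigr => k _; congr (_ * _).
  rewrite mul_mx_diag !mxE //.
have d_ge0 k : 0 <= d 0 k.
  have PA : P *m A *m P^t* = diag_mx d.
    rewrite {1}Adec !mulmxA.
    have /unitarymxP PP := spectral_unitarymx A.
    by rewrite -/P in PP; rewrite PP mul1mx -mulmxA PP mulmx1.
  have := pf n (fun i => P k i) x.
  have := congr1 (fun M : 'M[C]_n => M k k) PA; rewrite !mxE eqxx mulr1n => <-.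
  congr (_ <= _); under [RHS]eq_bigr do rewrite !mxE big_distrl/=.
  rewrite exchange_big; apply: eq_bigr => i _; apply: eq_bigr => j _.
  by rewrite !mxE; ring.
have E : \sum_i \sum_j c i * (c j)^* * (f \* g) ((x j)^-1 * x i)%g =
    \sum_k d 0 k * \sum_i \sum_j (c i * (P k i)^* ) * (c j * (P k j)^* )^* *
      g ((x j)^-1 * x i)%g.
  under [RHS]eq_bigr do rewrite big_distrr/=.
  rewrite [RHS]exchange_big/=; apply: eq_bigr => i _.
  under [RHS]eq_bigr do rewrite big_distrr/=.
  rewrite [RHS]exchange_big/=; apply: eq_bigr => j _.
  have := AE i j; rewrite mxE => fE; rewrite /= fE.
  rewrite mulr_suml mulr_sumr; apply: eq_bigr => k _.
  by rewrite rmorphM/= conjCK; ring.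
by rewrite E; apply: sumr_ge0 => k _; exact/mulr_ge0/pg.
Qed.
Lemma positive_definite_cst1 : positive_definite (cst 1).
Proof.
move=> n c x; rewrite (_ : \sum_i _ = (\sum_i c i) * (\sum_i c i)^* ).
  exact: mul_conjC_ge0.
rewrite rmorph_sum/= mulr_suml; apply: eq_bigr => i _.
by rewrite mulr_sumr; apply: eq_bigr => j _; rewrite mulr1.
Qed.

Lemma positive_definite_twist f (a : G) (t : C) : positive_definite f ->
  positive_definite (fun y => f y + t^* * f (a * y)%g + t * f (y * a^-1)%g
    + t * t^* * f (a * y * a^-1)%g).
Proof.
move=> pf n c x.
pose c' (i : 'I_(n + n)) := match fintype.split i with
  | inl j => c j | inr j => c j * t end.
pose x' (i : 'I_(n + n)) := match fintype.split i with
  | inl j => x j | inr j => (x j * a^-1)%g end.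
have := pf _ c' x'.
congr (0 <= _).
have cl i : c' (lshift n i) = c i by rewrite /c' -[lshift _ _]/(unsplit (inl i)) unsplitK.
have cr i : c' (rshift n i) = c i * t by rewrite /c' -[rshift _ _]/(unsplit (inr i)) unsplitK.
have xl i : x' (lshift n i) = x i by rewrite /x' -[lshift _ _]/(unsplit (inl i)) unsplitK.
have xr i : x' (rshift n i) = (x i * a^-1)%g by rewrite /x' -[rshift _ _]/(unsplit (inr i)) unsplitK.
rewrite big_split_ord/= -big_split/=; apply: eq_bigr => i _.
rewrite !big_split_ord/= -!big_split/=; apply: eq_bigr => j _.
rewrite !cl !cr !xl !xr !rmorphM/= !invgM !invgK !mulgA.
by ring.
Qed.
End PositiveDefinite.

Section FourierStieltjes.
Variables (R : realType) (G : topologicalGroupType).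
Local Notation C := (cplx R).

Definition FSpred : {pred G -> C} := fun g =>
  `[< exists n (c : 'I_n -> C) (p : 'I_n -> G -> C),
      (forall i, positive_definite (p i) /\ continuous (p i)) /\
      g = (fun x => \sum_i c i * p i x) >].

Lemma FSpred_posdef p : positive_definite p -> continuous p -> p \in FSpred.
Proof.
move=> pp pc; apply/asboolP; exists 1%N, (fun=> 1), (fun=> p); split=> //.
by apply/funext => x; rewrite big_ord1 mul1r.
Qed.

Lemma FSpredD g h : g \in FSpred -> h \in FSpred -> g \+ h \in FSpred.
Proof.
move=> /asboolP[n [c [p [pP ->]]]] /asboolP[m [d [q [qP ->]]]].
apply/asboolP; exists (n + m)%N.
exists (fun i => match fintype.split i with inl j => c j | inr j => d j end).
exists (fun i => match fintype.split i with inl j => p j | inr j => q j end).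
split; first by move=> i; case: fintype.split.
apply/funext => x /=; rewrite big_split_ord/=; congr (_ + _); apply: eq_bigr => i _.
  by rewrite -[lshift _ _]/(unsplit (inl i)) unsplitK.
by rewrite -[rshift _ _]/(unsplit (inr i)) unsplitK.
Qed.

Lemma FSpredZ (a : C) g : g \in FSpred -> (fun x => a * g x) \in FSpred.
Proof.
move=> /asboolP[n [c [p [pP ->]]]].
apply/asboolP; exists n, (fun i => a * c i), p; split=> //.
by apply/funext => x; rewrite mulr_sumr; apply: eq_bigr => i _; rewrite mulrA.
Qed.

Lemma FSpred0 : (fun=> 0) \in FSpred.
Proof.
rewrite (_ : (fun=> 0) = (fun x : G => 0 * cst 1 x)).
  apply/FSpredZ/FSpred_posdef; first exact: positive_definite_cst1.
  by move=> x; exact: cvg_cst.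
by apply/funext => x; rewrite mul0r.
Qed.

Lemma FSpred_sum n (F : 'I_n -> G -> C) :
  (forall i, F i \in FSpred) -> (fun x => \sum_i F i x) \in FSpred.
Proof.
elim: n F => [|n IH] F FP.
  rewrite (_ : (fun x => _) = (fun=> 0)); first exact: FSpred0.
  by apply/funext => x; rewrite big_ord0.
rewrite (_ : (fun x => _) = F ord0 \+ (fun x => \sum_i F (lift ord0 i) x)).
  by apply: FSpredD; [exact: FP|apply: IH => i; exact: FP].
by apply/funext => x; rewrite big_ord_recl.
Qed.

Lemma FSpredM g h : g \in FSpred -> h \in FSpred -> g \* h \in FSpred.
Proof.
move=> /asboolP[n [c [p [pP ->]]]] /asboolP[m [d [q [qP ->]]]].
rewrite (_ : _ \* _ = fun x => \sum_i \sum_j c i * (d j * (p i \* q j) x)).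
  apply: FSpred_sum => i; apply: FSpred_sum => j; do 2 apply: FSpredZ.
  have [[H1 H2] [H3 H4]] := (pP i, qP j).
  apply: FSpred_posdef; first exact: positive_definiteM.
  by move=> x; apply: (@cvgM _ _ _ _ (p i) (q j)); [exact: H2|exact: H4].
apply/funext => x /=; rewrite mulr_suml; apply: eq_bigr => i _.
by rewrite mulr_sumr; apply: eq_bigr => j _; ring.
Qed.

Lemma FSpred_adj g : g \in FSpred -> (fun x => (g x^-1%g)^* ) \in FSpred.
Proof.
move=> /asboolP[n [c [p [pP ->]]]].
apply/asboolP; exists n, (fun i => (c i)^* ), p; split=> //.
apply/funext => x; rewrite rmorph_sum/=; apply: eq_bigr => i _.
have [? _] := pP i.
by rewrite rmorphM/= positive_definiteV// conjCK.
Qed.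

Lemma mulg_continuousl (a : G) : continuous (fun y : G => (a * y)%g).
Proof.
move=> y; apply: (@continuous_comp _ _ _ (fun z : G => (a, z))
  (fun xy : G * G => (xy.1 * xy.2)%g)); last exact: mulg_continuous.
by apply: cvg_pair; [exact: cvg_cst|exact: cvg_id].
Qed.

Lemma mulg_continuousr (a : G) : continuous (fun y : G => (y * a)%g).
Proof.
move=> y; apply: (@continuous_comp _ _ _ (fun z : G => (z, a))
  (fun xy : G * G => (xy.1 * xy.2)%g)); last exact: mulg_continuous.
by apply: cvg_pair; [exact: cvg_id|exact: cvg_cst].
Qed.

Lemma FSpred_ltrans (a : G) g : g \in FSpred -> (fun y => g (a * y)%g) \in FSpred.
Proof.
move=> /asboolP[n [c [p [pP ->]]]]; apply: FSpred_sum => i; apply: FSpredZ.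
have [pp pc] := pP i; set f := p i in pp pc *.
pose q (t : C) y := f y + t^* * f (a * y)%g + t * f (y * a^-1)%g
    + t * t^* * f (a * y * a^-1)%g.
have c1 : continuous (fun y => f (a * y)%g).
  by move=> y; apply: continuous_comp; [exact: mulg_continuousl|exact: pc].
have c2 : continuous (fun y => f (y * a^-1)%g).
  by move=> y; apply: continuous_comp; [exact: mulg_continuousr|exact: pc].
have c3 : continuous (fun y => f (a * y * a^-1)%g).
  move=> y; apply: (@continuous_comp _ _ _ (fun y => a * y)%g (fun y => f (y * a^-1)%g)).
    exact: mulg_continuousl.
  exact: c2.
have qFS t : q t \in FSpred.
  apply: FSpred_posdef; first exact: positive_definite_twist.
  move=> y; do ![apply: cvgD | apply: cvgM | exact: cvg_cst].
  - exact: pc.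
  - exact: c1.
  - exact: c2.
  - exact: c3.
rewrite (_ : (fun y => _) = (fun y => 4^-1 * q 1 y) \+ (fun y => - 4^-1 * q (-1) y)
   \+ (fun y => (4^-1 * 'i) * q 'i y) \+ (fun y => - (4^-1 * 'i) * q (- 'i) y)).
  by do 3?apply: FSpredD; apply: FSpredZ.
apply/funext => y /=; rewrite /q !rmorphN /= !conjCi rmorph1.
have i2 : 'i * 'i = -1 :> C by rewrite -expr2 sqrCi.
set u := f (a * y)%g; set v := f (y * a^-1)%g.
transitivity (4^-1 * (2 * u + 2 * v) + ('i * 'i) * 4^-1 * (2 * v - 2 * u)).
  by rewrite i2; field.
by ring.
Qed.

Lemma FSpred_subring : subring_closed FSpred.
Proof.
split=> [|g h gP hP|g h]; last exact: FSpredM.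
  apply: FSpred_posdef; first exact: positive_definite_cst1.
  by move=> x; exact: cvg_cst.
rewrite (_ : g - h = g \+ (fun x => -1 * h x)).
  by apply: FSpredD => //; exact: FSpredZ.
by apply/funext => x /=; rewrite mulN1r.
Qed.
End FourierStieltjes.

(* B(G), the linear span of the continuous positive definite functions, as a
   commutative unital algebra under the pointwise operations. *)
Record FourierStieltjes (R : realType) (G : topologicalGroupType) :=
  MkFourierStieltjes {
    FSfun :> G -> cplx R;
    FSfunP : FSfun \in @FSpred R G }.

Section FourierStieltjesAlgebra.
Variables (R : realType) (G : topologicalGroupType).
Local Notation C := (cplx R).
Local Notation B := (FourierStieltjes R G).

HB.instance Definition _ := [isSub for @FSfun R G].
HB.instance Definition _ := [Choice of B by <:].
HB.instance Definition _ :=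
  GRing.SubChoice_isSubComPzRing.Build (G -> C) (@FSpred R G) B (@FSpred_subring R G).

Lemma FS_oner_neq0 : (1 : B) != 0.
Proof.
by apply/eqP => /(congr1 (fun g : B => g 1%g))/eqP; rewrite oner_eq0.
Qed.

HB.instance Definition _ := GRing.PzSemiRing_isNonZero.Build B FS_oner_neq0.

Definition FSscale (a : C) (g : B) : B := MkFourierStieltjes (FSpredZ a (FSfunP g)).

Lemma FSscaleA a b g : FSscale a (FSscale b g) = FSscale (a * b) g.
Proof. by apply/val_inj/funext => x /=; rewrite mulrA. Qed.

Lemma FSscale1 : left_id 1 FSscale.
Proof. by move=> g; apply/val_inj/funext => x /=; rewrite mul1r. Qed.

Lemma FSscaleDr : right_distributive FSscale +%R.
Proof. by move=> a g h; apply/val_inj/funext => x /=; exact: mulrDr. Qed.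

Lemma FSscaleDl g : {morph FSscale^~ g : a b / a + b}.
Proof. by move=> a b; apply/val_inj/funext => x /=; exact: mulrDl. Qed.

HB.instance Definition _ :=
  GRing.Zmodule_isLmodule.Build C B FSscaleA FSscale1 FSscaleDr FSscaleDl.

Lemma FSscaleAl a (g h : B) : a *: (g * h) = (a *: g) * h.
Proof. by apply/val_inj/funext => x /=; exact: mulrA. Qed.

HB.instance Definition _ := GRing.Lmodule_isLalgebra.Build C B FSscaleAl.
HB.instance Definition _ := GRing.Lalgebra_isComAlgebra.Build C B.

End FourierStieltjesAlgebra.

Section FullGroupCstarAlgebra.
Variables (R : realType) (G : topologicalGroupType).
Local Notation C := (cplx R).

Definition borel_carrier : Type := G.
HB.instance Definition _ := Choice.on borel_carrier.
HB.instance Definition _ := isPointed.Build borel_carrier 1%g.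
Definition borelType := g_sigma_algebraType (@open G : set (set borel_carrier)).

(* In a second countable locally compact Hausdorff group a Borel measure that is
   finite on compact sets is automatically regular. *)
Definition left_haar (mu : {measure set borelType -> \bar R}) : Prop :=
  [/\ forall (x : G) (A : set borelType), measurable A ->
        mu [set (x * y)%g | y in (A : set G)] = mu A,
      forall K : set G, compact K -> (mu (K : set borelType) < +oo)%E
    & mu setT <> 0%E].

Variable mu : {measure set borelType -> \bar R}.

Definition L1 (h : G -> C) : Prop :=
  mu.-integrable setT (fun x : borelType => (complex.Re (h x))%:E) /\
  mu.-integrable setT (fun x : borelType => (complex.Im (h x))%:E).

Definition cintegral (h : G -> C) : C :=
  ((\int[mu]_(x in setT) complex.Re (h x)) +i*
   (\int[mu]_(x in setT) complex.Im (h x)))%C.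

(* Strongly continuous unitary representations on a Hilbert space: a complete
   normed space whose norm comes from the inner product [inner]. *)
Record unitary_rep (H : completeNormedModType C) := UnitaryRep {
  inner : H -> H -> C;
  inner_linear : forall w, scalar (inner^~ w);
  inner_conj : forall v w, inner w v = (inner v w)^*;
  inner_norm : forall v, `|v| ^+ 2 = inner v v;
  act : G -> H -> H;
  act_linear : forall x, linear (act x);
  act1 : forall v, act 1%g v = v;
  actM : forall x y v, act (x * y)%g v = act x (act y v);
  act_unitary : forall x v w, inner (act x v) (act x w) = inner v w;
  act_continuous : forall v, continuous (act^~ v) }.

(* sup_pi ||pi(h)||, where <pi(h)v, w> = \int h(x) <pi(x)v, w> dx; C*(G) is the
   completion of L^1(G) for this norm. *)
Definition Cstar_norm (h : G -> C) : R :=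
  sup [set r | exists (H : completeNormedModType C) (pi : unitary_rep H) (v w : H),
    [/\ `|v| <= 1, `|w| <= 1 &
        r%:C%C = `|cintegral (fun x => h x * inner pi (act pi x v) w)|]].

End FullGroupCstarAlgebra.

Section EnvelopingVonNeumannAlgebra.
Variables (R : realType) (G : topologicalGroupType).
Local Notation C := (cplx R).
Local Notation B := (FourierStieltjes R G).
Implicit Types (f g : B) (u v z : B -> C).

(* The norm of g as the functional h |-> \int g h on C*(G). Rescaling the Haar
   measure only rescales h, so every choice of it gives the same value. *)
Definition FSnorm g : R :=
  sup [set r | exists (mu : {measure set (borelType G) -> \bar R}) (h : G -> C),
    [/\ left_haar mu, L1 mu h, Cstar_norm mu h <= 1 &
        r%:C%C = `|cintegral mu (fun x => g x * h x)|]].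

Definition Wstar : set (B -> C) :=
  [set u | scalar u /\ exists M : R, forall g, `|u g| <= (M * FSnorm g)%:C%C].

Definition FSltrans (x : G) g : B := MkFourierStieltjes (FSpred_ltrans x (FSfunP g)).

Definition FSadj g : B := MkFourierStieltjes (FSpred_adj (FSfunP g)).

Definition toFS (h : G -> C) : B := insubd (0 : B) h.

(* The product of W*(G) = C*(G)**, written on its predual B(G). If g is the
   coefficient <pi(.)a, b> of a unitary representation, extended to W*(G) by
   u(g) = <pi(u)a, b>, then
     v(y |-> g(xy)) = <pi(v)a, pi(x^-1)b> = <pi(x)pi(v)a, b>,
   which is again a coefficient in x (so [toFS] does not fall on its default
   value for v in W*(G)), and u of it is <pi(u)pi(v)a, b>. Likewise
   <pi(u)^* a, b> = (u(g^* ))^* for g^* (x) = (g(x^-1))^*. *)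
Definition Wmul u v : B -> C := fun g => u (toFS (fun x => v (FSltrans x g))).

Definition Wadj u : B -> C := fun g => (u (FSadj g))^*.

Definition Wdelta (x : G) : B -> C := fun g => g x.

Definition Wone : B -> C := Wdelta 1%g.

Lemma WmulDelta x y : Wmul (Wdelta x) (Wdelta y) = Wdelta (x * y)%g.
Proof.
apply/funext => g; rewrite /Wmul /Wdelta /toFS insubdK//.
rewrite (_ : (fun a => _) = FSadj (FSltrans (y^-1)%g (FSadj g))).
  exact: FSfunP.
by apply/funext => a /=; rewrite invgM !invgK conjCK.
Qed.

Definition central_projection z : Prop :=
  [/\ Wstar z, Wadj z = z, Wmul z z = z &
      forall u, Wstar u -> Wmul z u = Wmul u z].

(* The order z <= w of projections. *)
Definition proj_le z w : Prop := Wmul z w = z.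

Definition vanishes_off g z : Prop :=
  forall u, Wstar u -> Wmul (Wone - z) u g = 0.

Definition is_central_support g z : Prop :=
  [/\ central_projection z, vanishes_off g z &
      forall z', central_projection z' -> vanishes_off g z' -> proj_le z z'].

(* The smallest such projection always exists, since the central projections of
   a von Neumann algebra form a complete lattice; 0 is only a default value. *)
Definition zs g : B -> C := xget 0 [set z | is_central_support g z].

Definition abs_cont g f : Prop := proj_le (zs g) (zs f).

Definition Aof f : set B := [set g | abs_cont g f].

Definition restr f u (h : Aof f) : C := u (val h).

(* A(f)^* carries the operations for which restriction W*(G) -> A(f)^* is a
   unital *-homomorphism; this says that the restriction of u is unitary. *)
Definition restr_unitary f u : Prop :=
  @restr f (Wmul (Wadj u) u) = @restr f Wone /\
  @restr f (Wmul u (Wadj u)) = @restr f Wone.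

End EnvelopingVonNeumannAlgebra.

Section ShilovBoundary.
Variables (R : realType) (A : comAlgType (cplx R)).

(* {ptws A -> _} carries the topology of pointwise convergence, which induces
   the weak* topology on the spectrum. *)
Definition spectrum : set {ptws A -> cplx R} :=
  [set phi | [/\ scalar phi, {morph phi : a b / a * b} & exists a, phi a != 0]].

Definition is_boundary (K : set {ptws A -> cplx R}) : Prop :=
  [/\ K `<=` spectrum,
      exists2 F, closed F & K = spectrum `&` F
    & forall a, exists2 psi, K psi &
        forall chi, spectrum chi -> `|chi a| <= `|psi a|].

(* The intersection of all boundaries, which by Shilov's theorem is itself a
   boundary. *)
Definition shilov_boundary : set {ptws A -> cplx R} :=
  smallest is_boundary set0.

End ShilovBoundary.

(* Main.v *)
(* A character psi of B(G) satisfies |psi(p)| <= p(1) for continuous positive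
   definite p, because 1 - t p is invertible in B(G) when |t| p(1) < 1. Unitarity
   of phi makes f |-> T f, T f(x) = (phi(y |-> f(x^-1 y)))^*, a conjugate-linear
   ring automorphism of B(G) with phi(T f) = f(1) for f positive definite, and
   psi o T, conjugated, is again a character for every character psi. Hence T f
   attains its maximal modulus 1 at phi when f is positive definite with
   f(1) = 1, so any boundary K contains some psi with |psi(T f)| = 1. Replacing f
   by (1 + f) / 2 gives psi(T f) = 1 = phi(T f), and products of such f handle
   finitely many conditions at once. As the T f span B(G), phi is a weak* limit of
   points of the closed set K. *)
Require Import Defs.
From HB Require Import structures.
From mathcomp Require Import all_boot all_order all_algebra.
From mathcomp Require Import all_classical all_reals all_analysis.
From mathcomp Require Import ring.
From mathcomp.real_closed Require Import complex.

Set Implicit Arguments.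
Unset Strict Implicit.
Unset Printing Implicit Defensive.

Import Order.TTheory GRing.Theory Num.Theory.
Import numFieldNormedType.Exports.
Local Open Scope classical_set_scope.
Local Open Scope ring_scope.

(** * Elementary estimates for complex numbers *)

Section NumClosed.
Variable C : numClosedFieldType.
Implicit Types a z : C.

Lemma ge0_approx a :
  (forall e, 0 < e -> exists2 b, 0 <= b & `|a - b| <= e) -> 0 <= a.
Proof.
move=> H; rewrite ger0_def -subr_eq0 -normr_eq0.
apply/negPn/negP => n0.
have gt0 : 0 < `| `|a| - a| by rewrite lt_def n0 normr_ge0.
(* With [b] real and nonnegative, the gap is at most two errors [|a - b|]; a quarter of the gap each
   makes it at most half of itself. *)
have [b b0 ab] := H (`| `|a| - a| / 4) (divr_gt0 gt0 (ltr0n _ 4)).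
have : `| `|a| - a| <= `| `|a| - a| / 4 + `| `|a| - a| / 4.
  rewrite [X in X <= _](_ : _ = `|(`|a| - `|b|) + (b - a)|); last first.
    by rewrite (ger0_norm b0) addrA subrK.
  apply: (le_trans (ler_normD _ _)); apply: lerD.
    exact/(le_trans _ ab)/ler_dist_dist.
  by rewrite distrC.
rewrite -mulrDr ler_pMr// => /le_gtF.
suff -> : 4^-1 + 4^-1 < 1 :> C by [].
by rewrite -(ltr_pM2r (ltr0n C 4)) mulrDl mulVf ?pnatr_eq0// mul1r -(natrD _ 1 1) ltr_nat.
Qed.

Lemma sum_geom z n : z != 1 -> \sum_(i < n) z ^+ i = (1 - z ^+ n) / (1 - z).
Proof.
move=> z1; have z1' : 1 - z != 0 by rewrite subr_eq0 eq_sym.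
apply: (canRL (mulfK z1')); rewrite mulrC -(opprB z) mulNr -subrX1.
by rewrite opprB.
Qed.

(** Provides the nonnegative power series coefficients in [resolvent_positive_definite]. *)
Lemma conjC_add_ge z : - (2 * `|z|) <= z + z^*.
Proof.
have -> : z + z^* = 2 * 'Re z by rewrite ReE mulrC divfK ?pnatr_eq0.
rewrite -mulrN ler_pM2l ?ltr0n//.
have [+ _] := leif_normC_Re_Creal z.
by rewrite real_ler_norml ?Creal_Re// => /andP[].
Qed.

Lemma norm_subr1_ge z r : `|z| <= r -> 1 - r <= `|1 - z|.
Proof.
move=> zr; rewrite lerBlDr -[X in X <= _](@normr1 C).
rewrite -{1}(subrK z 1); apply: (le_trans (ler_normD _ _)).
by rewrite lerD2l.
Qed.

Lemma midpoint_norm_ge1 z : `|z| <= 1 -> 1 <= `|2^-1 * (z + 1)| -> z = 1.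
Proof.
move=> z1; rewrite normrM ger0_norm ?invr_ge0// ler_pdivlMl// mulr1 => z2.
apply/eqP; rewrite -subr_eq0 -normr_eq0 -sqrf_eq0.
rewrite eq_le exprn_ge0// andbT.
(* Parallelogram law for [z] and 1; the hypotheses give [|z| <= 1] and [|z + 1| >= 2], so the right
   side is at most 0. *)
have -> : `|z - 1| ^+ 2 = 2 * `|z| ^+ 2 + 2 - `|z + 1| ^+ 2.
  by rewrite !normCK !rmorphB !rmorphD rmorph1; ring.
rewrite lerBlDr add0r; apply: (@le_trans _ _ (2 ^+ 2)); last first.
  by rewrite lerXn2r ?nnegrE.
rewrite (_ : 2 ^+ 2 = 2 * 1 + 2); last by rewrite mulr1 expr2 mulr_natr.
by rewrite lerD2r ler_pM2l// expr_le1.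
Qed.

End NumClosed.

(** * Positive definite functions and their resolvents *)

Section PositiveDefinite.
Variables (R : realType) (G : topologicalGroupType).
Local Notation C := (cplx R).
Implicit Types p : G -> C.

Lemma expr_lt_eps (r e : C) : 0 <= r -> r < 1 -> 0 < e -> exists n, r ^+ n < e.
Proof.
have ge0P (z : C) : 0 <= z -> exists2 x : R, 0 <= x & z = x%:C%C.
  move=> z0; exists (complex.Re z).
    by move: z0; rewrite lecE => /andP[].
  by move: z0; case: z => a b; rewrite lecE /= => /andP[/eqP-> _].
move=> r0 r1 e0.
have [x x0 rx] := ge0P _ r0; have [y _ ey] := ge0P _ (ltW e0).
rewrite rx ltcR in r1; rewrite ey ltcR in e0.
have x1 : `|x| < 1 by rewrite ger0_norm.
have /cvgrPdist_lt/(_ y e0) := cvg_expr x1.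
move=> [n _ /(_ n (leqnn n))]; rewrite sub0r normrN ger0_norm ?exprn_ge0// => H.
by exists n; rewrite rx ey -rmorphXn ltcR.
Qed.

Lemma positive_definite_norm_le p x : positive_definite p -> `|p x| <= p 1%g.
Proof.
move=> pp; have p1 := positive_definite_ge0 pp.
have [->|px0] := eqVneq (p x) 0; first by rewrite normr0.
have npx0 : `|p x| != 0 by rewrite normr_eq0.
(* A unimodular [t] with [t * p x = - |p x|]: the form at the points 1, [x] with coefficients 1, [t]
   is then twice [p 1 - |p x|]. *)
pose t : C := - (p x)^* / `|p x|.
have tt : t * t^* = 1.
  by rewrite -normCK normrM normrN norm_conjC normfV normr_id divff// expr1n.
have tp : t * p x = - `|p x|.
  by rewrite /t -mulrA (mulrC _ (p x)) mulrA mulNr (mulrC (_^*)) -normCK expr2 mulNr mulfK.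
have := pp 2%N (fun i => if i == 0 then 1 else t)
    (fun i => if i == 0 then 1%g else x).
rewrite !big_ord_recl !big_ord0 /= !addr0 rmorph1 !mul1r !mulVg !mulr1.
rewrite invg1 mul1g mulg1 positive_definiteV// -rmorphM/= tt tp.
rewrite rmorphN /= geC0_conj// mul1r.
by rewrite (addrC (- _)) -mulr2n pmulrn_lge0// subr_ge0.
Qed.

Lemma positive_definite_sum n (d : 'I_n -> C) (p : 'I_n -> G -> C) :
  (forall i, 0 <= d i) -> (forall i, positive_definite (p i)) ->
  positive_definite (fun x => \sum_i d i * p i x).
Proof.
move=> d0 pp m c x.
rewrite (_ : \sum_i _ =
  \sum_k d k * \sum_i \sum_j c i * (c j)^* * p k ((x j)^-1 * x i)%g).
  by apply: sumr_ge0 => k _; exact/mulr_ge0/pp.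
under [RHS]eq_bigr do rewrite mulr_sumr.
rewrite [RHS]exchange_big; apply: eq_bigr => i _ /=.
under [RHS]eq_bigr do rewrite mulr_sumr.
rewrite [RHS]exchange_big; apply: eq_bigr => j _ /=.
by rewrite mulr_sumr; apply: eq_bigr => k _; rewrite mulrCA.
Qed.

Lemma positive_definiteX p n :
  positive_definite p -> positive_definite (fun x => p x ^+ n).
Proof.
move=> pp; elim: n => [|n IH]; first exact: positive_definite_cst1.
by under eq_fun do rewrite exprS; exact: (positive_definiteM pp IH).
Qed.

Lemma positive_definite_limit (f : G -> C) :
  (forall e, 0 < e -> exists2 p, positive_definite p & forall x, `|f x - p x| <= e) ->
  positive_definite f.
Proof.
move=> H n c x; apply: ge0_approx => e e0.
pose S := \sum_i \sum_j `|c i * (c j)^*| : C.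
(* The 1 is added because [S] may vanish and the tolerance is divided by it. *)
have S0 : 0 < S + 1.
  by rewrite ltr_wpDl// sumr_ge0// => i _; rewrite sumr_ge0.
have [p pp fp] := H (e / (S + 1)) (divr_gt0 e0 S0).
exists (\sum_i \sum_j c i * (c j)^* * p ((x j)^-1 * x i)%g); first exact: pp.
rewrite -sumrB; apply: (@le_trans _ _ (S * (e / (S + 1)))).
  rewrite mulr_suml; apply: (le_trans (ler_norm_sum _ _ _)); apply: ler_sum => i _.
  rewrite -sumrB mulr_suml; apply: (le_trans (ler_norm_sum _ _ _)).
  apply: ler_sum => j _; rewrite -mulrBr normrM.
  by apply: ler_wpM2l => //; exact: fp.
rewrite mulrCA ger_pMr// ler_pdivrMr// mul1r lerDl//.
Qed.

(** Expand in powers of [p]: the [i]-th coefficient is [2|t|^i] plus twice the real part of [u t^i],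
    hence nonnegative. Powers of [p] are positive definite, and the partial sums converge uniformly
    since [|p x| <= p 1]. *)
Lemma resolvent_positive_definite p (t u : C) : positive_definite p ->
  `|u| = 1 -> `|t| * p 1%g < 1 ->
  positive_definite (fun x => 2 / (1 - `|t| * p x) + u / (1 - t * p x)
    + u^* / (1 - t^* * p x)).
Proof.
move=> pp u1 tp1; set r := `|t| * p 1%g in tp1.
have r0 : 0 <= r by rewrite mulr_ge0// positive_definite_ge0.
have sr (s : C) x : `|s| = `|t| -> `|s * p x| <= r.
  by move=> st; rewrite normrM st ler_wpM2l// positive_definite_norm_le.
have r1 : 0 < 1 - r by rewrite subr_gt0.
have sr1 (s : C) x : `|s| = `|t| -> 1 - r <= `|1 - s * p x|.
  by move=> st; apply: norm_subr1_ge; exact: sr.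
have srn (s : C) x : `|s| = `|t| -> 1 - s * p x != 0.
  by move=> st; rewrite -normr_gt0; exact/(lt_le_trans r1)/sr1.
have sE (s : C) x n : `|s| = `|t| ->
    `|(1 - s * p x)^-1 - \sum_(i < n) s ^+ i * p x ^+ i| <= r ^+ n / (1 - r).
  move=> st; under eq_bigr do rewrite -exprMn.
  rewrite sum_geom; last by rewrite -subr_eq0 -opprB oppr_eq0 srn.
  rewrite -{1}(mul1r (_^-1)) -mulrBl subKr normrM normfV normrX.
  apply: ler_pM; rewrite ?exprn_ge0 ?invr_ge0//.
    by rewrite lerXn2r ?nnegrE// sr.
  by rewrite lef_pV2 ?posrE ?sr1//; exact/(lt_le_trans r1)/sr1.
apply: positive_definite_limit => e e0.
(* Makes each geometric tail at most [e / 4]; the three resolvents enter with weights 2, 1, 1. *)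
have [n rn] := expr_lt_eps r0 tp1 (mulr_gt0 r1 (divr_gt0 e0 (ltr0n _ 4))).
exists (fun x => \sum_(i < n) (2 * `|t| ^+ i + u * t ^+ i + u^* * t^* ^+ i)
   * p x ^+ i).
  apply: positive_definite_sum => i; last exact: positive_definiteX.
  have := conjC_add_ge (u * t ^+ i).
  by rewrite normrM normrX u1 mul1r rmorphM rmorphXn /= lerNl -subr_ge0 opprK addrA.
move=> x.
have -> : \sum_(i < n) (2 * `|t| ^+ i + u * t ^+ i + u^* * t^* ^+ i) * p x ^+ i =
    2 * (\sum_(i < n) `|t| ^+ i * p x ^+ i) + u * (\sum_(i < n) t ^+ i * p x ^+ i)
    + u^* * (\sum_(i < n) t^* ^+ i * p x ^+ i).
  rewrite !mulr_sumr -!big_split/=; apply: eq_bigr => i _; ring.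
rewrite (_ : _ - _ =
   2 * ((1 - `|t| * p x)^-1 - \sum_(i < n) `|t| ^+ i * p x ^+ i)
   + u * ((1 - t * p x)^-1 - \sum_(i < n) t ^+ i * p x ^+ i)
   + u^* * ((1 - t^* * p x)^-1 - \sum_(i < n) t^* ^+ i * p x ^+ i)); last by ring.
have rne : r ^+ n / (1 - r) <= e / 4 by rewrite ler_pdivrMr// mulrC ltW.
apply: (@le_trans _ _ (2 * (e / 4) + e / 4 + e / 4)); last first.
  by rewrite le_eqVlt (_ : _ + _ == e)//; apply/eqP; field.
apply: (le_trans (ler_normD _ _)); apply: lerD; last first.
  rewrite normrM norm_conjC u1 mul1r; apply: (le_trans _ rne); apply: sE.
  by rewrite norm_conjC.
apply: (le_trans (ler_normD _ _)); apply: lerD; last first.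
  by rewrite normrM u1 mul1r; apply: (le_trans _ rne); exact: sE.
rewrite normrM ger0_norm ?ler0n// ler_pM2l ?ltr0n//.
by apply: (le_trans _ rne); apply: sE; rewrite normr_id.
Qed.

Lemma FSpred_resolvent p (t : C) : positive_definite p -> continuous p ->
  `|t| * p 1%g < 1 -> (fun x => (1 - t * p x)^-1) \in @FSpred R G.
Proof.
move=> pp cp tp1.
pose q (u : C) x := 2 / (1 - `|t| * p x) + u / (1 - t * p x)
    + u^* / (1 - t^* * p x).
have cr (s : C) : `|s| = `|t| -> continuous (fun x => (1 - s * p x)^-1).
  move=> st x; apply: cvgV.
    rewrite -normr_gt0.
    apply: (lt_le_trans _ (norm_subr1_ge (r := `|t| * p 1%g) _)).
      by rewrite subr_gt0.
    by rewrite normrM st ler_wpM2l// positive_definite_norm_le.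
  apply: cvgB; first exact: cvg_cst.
  by apply: cvgM; [exact: cvg_cst|exact: cp].
have qFS u : `|u| = 1 -> q u \in @FSpred R G.
  move=> u1; apply: FSpred_posdef; first exact: resolvent_positive_definite.
  move=> x; apply: cvgD; first apply: cvgD; apply: cvgM; first [exact: cvg_cst|apply: cr].
  - by rewrite normr_id.
  - by [].
  - by rewrite norm_conjC.
(* Polarization over the fourth roots of unity: weighting [q u] by the conjugate of [u] cancels the
   terms in [|t|] and in the conjugate of [t]. *)
rewrite (_ : (fun x => _) = (fun x => 4^-1 * q 1 x) \+ (fun x => - 4^-1 * q (-1) x)
   \+ (fun x => - (4^-1 * 'i) * q 'i x) \+ (fun x => (4^-1 * 'i) * q (- 'i) x)).
  by do 3?apply: FSpredD; apply: FSpredZ; apply: qFS; rewrite ?normrN ?normr1 ?normCi.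
apply/funext => x /=; rewrite /q !rmorphN /= !conjCi rmorph1.
have i2 : 'i * 'i = -1 :> C by rewrite -expr2 sqrCi.
set X := (1 - t * p x)^-1; set Y := (1 - t^* * p x)^-1.
set Z := (1 - `|t| * p x)^-1.
transitivity (4^-1 * (2 * X + 2 * Y) + ('i * 'i) * 4^-1 * (2 * Y - 2 * X)).
  by rewrite i2; field.
by ring.
Qed.
End PositiveDefinite.

(** * Characters of B(G) and their bound on positive definite functions *)

Section Characters.
Variables (R : realType) (G : topologicalGroupType).
Local Notation C := (cplx R).
Local Notation B := (FourierStieltjes R G).
Implicit Types (g h p : B) (psi : B -> C).

Lemma FS_continuous g : continuous g.
Proof.
case: g => g /= /asboolP[n [c [p [pP ->]]]].
apply: continuous_big => [|i _ x]; first exact: add_continuous.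
by apply: cvgM; [exact: cvg_cst|exact: (pP i).2].
Qed.

(** A positive definite [p] with [p 1 = 0] is zero because [p 1] bounds [|p|]; any other can be
    rescaled to [p 1 = 1]. *)
Lemma FS_span_ind (P : B -> Prop) :
  P 0 -> (forall a g h, P g -> P h -> P (a *: g + h)) ->
  (forall p, positive_definite p -> p 1%g = 1 -> P p) -> forall g, P g.
Proof.
move=> P0 PD Pp.
have Ppos p : positive_definite p -> P p.
  move=> pp; have p1 := positive_definite_ge0 pp.
  have [p10|p10] := eqVneq (p 1%g) 0.
    suff -> : p = 0 by [].
    apply/val_inj/funext => x; apply/eqP; rewrite -normr_le0 -p10.
    exact: positive_definite_norm_le.
  rewrite -(scalerKV p10 p) -[X in P X]addr0; apply: PD => //; apply: Pp.
    move=> n c x; have := pp n c x.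
    rewrite -(pmulr_rge0 _ (_ : 0 < (p 1%g)^-1)) ?invr_gt0 ?lt_def ?p10//.
    congr (_ <= _); rewrite mulr_sumr; apply: eq_bigr => i _.
    by rewrite mulr_sumr; apply: eq_bigr => j _; rewrite mulrCA.
  by rewrite /= mulVf.
case=> g gP; move/asboolP: (gP) => [n [c [p [pP gE]]]].
pose q i := MkFourierStieltjes (FSpred_posdef (pP i).1 (pP i).2).
rewrite (_ : MkFourierStieltjes gP = \sum_i c i *: q i).
  elim/big_ind: _ => //; first by move=> u v Pu Pv; rewrite -(scale1r u); exact: PD.
  move=> i _; rewrite -[X in P X]addr0; apply: PD => //; apply: Ppos.
  exact: (pP i).1.
apply/val_inj => /=; rewrite gE; apply/funext => x.
by elim/big_rec2: _ => //= i y z _ ->.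
Qed.

Section Character.
Variables (psi : B -> C) (psiS : spectrum psi).

Lemma spectrum_linear a g h : psi (a *: g + h) = a * psi g + psi h.
Proof. by case: psiS => + _ _; apply. Qed.

Lemma spectrumM g h : psi (g * h) = psi g * psi h.
Proof. by case: psiS => _ + _; apply. Qed.

Lemma spectrum0 : psi 0 = 0.
Proof.
by have := spectrum_linear (-1) 0 0; rewrite scaler0 addr0 mulN1r addNr.
Qed.

Lemma spectrum1 : psi 1 = 1.
Proof.
case: psiS => _ _ [a a0]; apply: (mulfI a0).
by rewrite -spectrumM !mulr1.
Qed.

(** Otherwise [1 - p / psi p] has an inverse in B(G), given by the resolvent, although [psi] sends
    it to 0. *)
Lemma spectrum_norm_le p : positive_definite p -> `|psi p| <= p 1%g.
Proof.
move=> pp; have p1 := positive_definite_ge0 pp.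
rewrite real_leNgt ?normr_real ?ger0_real//; apply/negP => lt.
have l0 : 0 < `|psi p| := le_lt_trans p1 lt.
have l0' : psi p != 0 by rewrite -normr_gt0.
have tp1 : `|(psi p)^-1| * p 1%g < 1.
  by rewrite normfV mulrC ltr_pdivrMr// mul1r.
pose r : B := MkFourierStieltjes (FSpred_resolvent pp (@FS_continuous p) tp1).
have E : (- (psi p)^-1 *: p + 1) * r = 1.
  apply/val_inj/funext => x.
  change ((- (psi p)^-1 * p x + 1) / (1 - (psi p)^-1 * p x) = 1).
  rewrite mulNr addrC divff//.
  rewrite -normr_gt0.
  apply: (lt_le_trans _ (norm_subr1_ge (r := `|(psi p)^-1| * p 1%g) _)).
    by rewrite subr_gt0.
  by rewrite normrM ler_wpM2l// positive_definite_norm_le.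
have := congr1 psi E.
rewrite spectrumM spectrum_linear spectrum1 mulNr mulVf// addNr mul0r.
by move/esym/eqP; rewrite oner_eq0.
Qed.
End Character.

(** * Evaluating identities in the dual of A(f) at f itself *)

Lemma abs_cont_refl g : abs_cont g g.
Proof.
(* A central support is idempotent, and so is the default value 0 of [zs]. *)
by rewrite /abs_cont /proj_le /zs; case: xgetP => [z _ [[_ _ zz _] _ _]|_].
Qed.

Lemma restr_self_eq g (u v : B -> C) : @restr R G g u = @restr R G g v -> u g = v g.
Proof.
have gA : g \in @Aof R G g by apply/mem_set/abs_cont_refl.
by move=> /(congr1 (fun F => F (exist _ g gA))).
Qed.

Lemma toFS_out (f : G -> C) : f \notin @FSpred R G -> toFS f = 0.
Proof. by move=> fn; rewrite /toFS /insubd insubN. Qed.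

Lemma toFSK (f : G -> C) (fP : f \in @FSpred R G) :
  toFS f = MkFourierStieltjes fP.
Proof. by apply/val_inj; rewrite /toFS insubdK. Qed.

(** * The twist by a unitary character and its inverse *)

Section Unitary.
Variables (phi : B -> C) (phiS : spectrum phi).
Variable (phiU : forall f : B, positive_definite f -> restr_unitary f phi).

Lemma FSadj0 : FSadj (0 : B) = 0.
Proof. by apply/val_inj/funext => x /=; rewrite conjC0. Qed.

Lemma ltrans_phi_FS g : (fun x => phi (FSltrans x g)) \in @FSpred R G.
Proof.
elim/FS_span_ind: g => [|a g h gP hP|p pp p1].
- rewrite (_ : (fun _ => _) = (fun=> 0)); first exact: FSpred0.
  by apply/funext => x; rewrite -(spectrum0 phiS); congr phi; exact: val_inj.
- rewrite (_ : (fun _ => _) =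
    (fun x => a * phi (FSltrans x g)) \+ (fun x => phi (FSltrans x h))).
    by apply: FSpredD => //; exact: FSpredZ.
  by apply/funext => x /=; rewrite -spectrum_linear//; congr phi; exact: val_inj.
(* Outside B(G), [toFS] would return its default 0, so the product of the adjoint of [phi] with
   [phi] would vanish at [p]; unitarity gives it the value [p 1 = 1]. *)
- have [/restr_self_eq + _] := phiU pp; apply: contraPT => /toFS_out T0.
  rewrite /Wmul T0 /Wadj FSadj0 spectrum0// conjC0 /Wone /Wdelta p1.
  by move/esym/eqP; rewrite oner_eq0.
Qed.

Lemma phi_adj_ltrans_FS g :
  (fun x => (phi (FSadj (FSltrans x g)))^*) \in @FSpred R G.
Proof.
elim/FS_span_ind: g => [|a g h gP hP|p pp p1].
- rewrite (_ : (fun _ => _) = (fun=> 0)); first exact: FSpred0.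
  apply/funext => x; rewrite -conjC0 -(spectrum0 phiS); congr (phi _)^*.
  by apply/val_inj/funext => y /=; rewrite conjC0.
- rewrite (_ : (fun _ => _) = (fun x => a * (phi (FSadj (FSltrans x g)))^*) \+
    (fun x => (phi (FSadj (FSltrans x h)))^*)).
    by apply: FSpredD => //; exact: FSpredZ.
  apply/funext => x /=; rewrite -[X in X * _]conjCK -rmorphM -rmorphD /=.
  rewrite -spectrum_linear//; congr (phi _)^*.
  by apply/val_inj/funext => y /=; rewrite rmorphD rmorphM.
(* The same argument with the other product, [phi] times its adjoint. *)
- have [_ /restr_self_eq] := phiU pp; apply: contraPT => /toFS_out T0.
  rewrite /Wmul /Wadj T0 spectrum0// /Wone /Wdelta p1.
  by move/esym/eqP; rewrite oner_eq0.
Qed.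

(* As functionals on W*(G), [twist g] is u |-> g^*(phi^* u) and [untwist g] is
   u |-> g(u phi^* ). *)
Definition twist g : B := FSadj (MkFourierStieltjes (ltrans_phi_FS g)).
Definition untwist g : B := MkFourierStieltjes (phi_adj_ltrans_FS g).

Lemma twist_linear a g h : twist (a *: g + h) = a^* *: twist g + twist h.
Proof.
apply/val_inj/funext => x.
change ((phi (FSltrans x^-1%g (a *: g + h)))^* =
  a^* * (phi (FSltrans x^-1%g g))^* + (phi (FSltrans x^-1%g h))^* ).
rewrite -rmorphM -rmorphD -spectrum_linear//=.
by congr (phi _)^*; exact: val_inj.
Qed.

Lemma twist0 : twist 0 = 0.
Proof.
have := twist_linear (-1) 0 0.
by rewrite scaler0 addr0 rmorphN rmorph1 scaleN1r addNr.
Qed.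

Lemma twistM g h : twist (g * h) = twist g * twist h.
Proof.
apply/val_inj/funext => x.
change ((phi (FSltrans x^-1%g (g * h)))^* =
  (phi (FSltrans x^-1%g g))^* * (phi (FSltrans x^-1%g h))^* ).
rewrite -rmorphM -spectrumM//=.
by congr (phi _)^*; exact: val_inj.
Qed.

Lemma twist1 : twist 1 = 1.
Proof.
apply/val_inj/funext => x; change ((phi (FSltrans x^-1%g 1))^* = 1).
rewrite -[RHS]conjC1 -(spectrum1 phiS).
by congr (phi _)^*; exact: val_inj.
Qed.

(** The isometry half of unitarity, evaluated at [p], with both sides conjugated. *)
Lemma phi_twist p : positive_definite p -> p 1%g = 1 -> phi (twist p) = 1.
Proof.
move=> pp p1; have [/restr_self_eq + _] := phiU pp.
rewrite /Wmul /Wadj (toFSK (ltrans_phi_FS p)) -[LHS]/((phi (twist p))^* ) => E.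
by rewrite -[LHS]conjCK E /Wone /Wdelta p1 conjC1.
Qed.

Lemma untwist_linear a g h : untwist (a *: g + h) = a *: untwist g + untwist h.
Proof.
apply/val_inj/funext => x.
change ((phi (FSadj (FSltrans x (a *: g + h))))^* =
  a * (phi (FSadj (FSltrans x g)))^* + (phi (FSadj (FSltrans x h)))^* ).
rewrite -[X in X * _]conjCK -rmorphM -rmorphD /= -spectrum_linear//.
congr (phi _)^*; apply/val_inj/funext => y /=.
by rewrite rmorphD rmorphM.
Qed.

(** The coisometry half of unitarity at positive definite functions, extended linearly to B(G). *)
Lemma phi_untwist g : phi (untwist g) = g 1%g.
Proof.
elim/FS_span_ind: g => [|a g h gP hP|p pp p1].
- rewrite [untwist 0](_ : _ = 0) ?spectrum0//.
  have := untwist_linear (-1) 0 0.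
  by rewrite scaler0 addr0 scaleN1r addNr.
- by rewrite untwist_linear spectrum_linear// gP hP.
- have [_ /restr_self_eq] := phiU pp.
  by rewrite /Wmul /Wadj (toFSK (phi_adj_ltrans_FS p)).
Qed.

(** Shows that every element of B(G) is a twist. It holds because [untwist] commutes with left
    translations, so that [phi_untwist] recovers each value of [g]. *)
Lemma twist_untwist g : twist (untwist (FSadj g)) = g.
Proof.
apply/val_inj/funext => x.
change ((phi (FSltrans x^-1%g (untwist (FSadj g))))^* = g x).
rewrite (_ : FSltrans _ _ = untwist (FSltrans x^-1%g (FSadj g))).
  by rewrite phi_untwist /= mulg1 invgK conjCK.
apply/val_inj/funext => y /=; congr (phi _)^*.
by apply/val_inj/funext => z /=; rewrite !mulgA.
Qed.

Lemma spectrum_twist psi : spectrum psi -> spectrum (fun g => (psi (twist g))^* ).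
Proof.
move=> psiS; split=> [a g h|g h|].
- by rewrite twist_linear spectrum_linear// rmorphD rmorphM /= conjCK.
- by rewrite twistM spectrumM// rmorphM.
- by exists 1; rewrite twist1 spectrum1// conjC1 oner_neq0.
Qed.

Lemma spectrum_twist_le1 psi p : spectrum psi -> positive_definite p ->
  p 1%g = 1 -> `|psi (twist p)| <= 1.
Proof.
move=> psiS pp p1; rewrite -norm_conjC -[X in _ <= X]p1.
exact: (spectrum_norm_le (spectrum_twist psiS)).
Qed.

(* If q = (1 + p) / 2 attains its maximal modulus at psi, strict convexity of
   the disc forces psi (twist p) = 1. *)
Lemma twist_peak psi p : spectrum psi -> positive_definite p -> p 1%g = 1 ->
  1 <= `|psi (twist (2^-1 *: (p + 1)))| -> psi (twist p) = 1.
Proof.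
move=> psiS pp p1.
have le1 := spectrum_twist_le1 psiS pp p1.
rewrite scalerDr -[2^-1 *: 1]addr0 !twist_linear !spectrum_linear//.
rewrite twist0 twist1 spectrum1// spectrum0// addr0 fmorphV rmorph_nat -mulrDr.
exact: midpoint_norm_ge1.
Qed.

(** * Approximating the unitary character from within a boundary *)

Lemma unitary_in_boundary K : is_boundary K -> K phi.
Proof.
move=> [KS [F clF KE] Kmax].
pose D : set B := [set p | positive_definite p /\ p 1%g = 1].
pose A p : set {ptws B -> C} := [set psi | K psi /\ 1 <= `|psi (twist p)|].
(* Each [A p] is nonempty because [twist p] attains its maximal modulus on K and takes the value 1
   at [phi]. Since the moduli are at most 1, [A (p * q)] lies in both [A p] and [A q]. *)
have FA : ProperFilter (filter_from D A).
  apply: filter_from_proper; last first.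
    move=> p [pp p1]; have [psi Kpsi /(_ phi phiS)] := Kmax (twist p).
    by rewrite phi_twist// normr1 => le; exists psi.
  apply: filter_from_filter.
    by exists 1; split=> //; exact: positive_definite_cst1.
  move=> p q [pp p1] [qq q1]; exists (p * q).
    split; last by change (p 1%g * q 1%g = 1); rewrite p1 q1 mulr1.
    exact: (positive_definiteM pp qq).
  move=> psi [Kpsi]; have psiS := KS _ Kpsi.
  rewrite twistM spectrumM// normrM => le.
  have lep := spectrum_twist_le1 psiS pp p1.
  have leq := spectrum_twist_le1 psiS qq q1.
  by split; split=> //; apply: (le_trans le); [rewrite ler_piMr|rewrite ler_piMl].
have ev g : \forall psi \near filter_from D A, K psi /\ psi (twist g) = phi (twist g).
  elim/FS_span_ind: g => [|a g h gP hP|p pp p1].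
  - exists 1; first by split=> //; exact: positive_definite_cst1.
    move=> psi [Kpsi _]; split=> //.
    by rewrite twist0 !spectrum0//; exact: KS.
  - near=> psi.
    have [Kpsi gE] : K psi /\ psi (twist g) = phi (twist g) by near: psi.
    have [_ hE] : K psi /\ psi (twist h) = phi (twist h) by near: psi.
    by split=> //; rewrite twist_linear !spectrum_linear ?gE ?hE//; exact: KS.
  (* The midpoint of [p] and 1 is again normalized and positive definite; on its set in the base,
     [twist_peak] gives equality and not only modulus 1. *)
  - exists (2^-1 *: (p + 1)).
      split; last first.
        change (2^-1 * (p 1%g + 1) = 1); rewrite p1; exact: mulVf.
      rewrite (_ : FSfun _ = fun x =>
          \sum_(i < 2) 2^-1 * (if i == 0 then p : G -> C else cst 1) x).
        apply: positive_definite_sum => i; first by rewrite invr_ge0.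
        by case: ifP => _ //; exact: positive_definite_cst1.
      by apply/funext => x; rewrite !big_ord_recl big_ord0 addr0 -mulrDr.
    move=> psi [Kpsi le]; split=> //; rewrite phi_twist//.
    by apply: twist_peak => //; exact: KS.
(* Pointwise convergence is tested on one [g] at a time; as [g] is a twist, the values [psi g] are
   eventually equal to [phi g]. *)
have cvgphi : filter_from D A --> (phi : {ptws B -> C}).
  apply/cvg_sup => g U [_ [[V oV <-] Vphi] sub].
  have := ev (untwist (FSadj g)); rewrite twist_untwist.
  by apply: filterS => psi [_ E]; apply: sub; rewrite /= E.
rewrite KE; split=> //.
apply: (@closed_cvg _ _ _ FA id F clF _ _ cvgphi).
(* Only the membership in K is taken from [ev 0]. *)
by apply: filterS (ev 0) => psi []; rewrite KE => -[].
Unshelve. all: by end_near. Qed.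

End Unitary.
End Characters.

Theorem theorem5p6 (R : realType) (G : topologicalGroupType)
    (G_hausdorff : hausdorff_space G)
    (G_locally_compact : locally_compact [set: G])
    (G_second_countable : @second_countable G)
    (phi : FourierStieltjes R G -> cplx R)
    (phi_spectrum : spectrum phi)
    (phi_unitary : forall f : FourierStieltjes R G,
        positive_definite f -> restr_unitary f phi) :
  shilov_boundary phi.
Proof. by move=> K [Kb _]; exact: unitary_in_boundary. Qed.
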